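(* For $n\ge1$ let $\mathrm{P}_n\subset\mathrm{GL}_n(\mathbb{R})$ be the set of real symmetric positive definite $n\times n$ matrices. Let $\omega$ be a non-principal ultrafilter on $\mathbb{N}$. Then the metric ultraproduct $\prod_{n\to\omega}(\mathrm{P}_n,\|\cdot\|_{\overline{\mathrm{rk}}})$ is contractible.
   Context: The rank norm of $g\in\mathrm{GL}_n(\mathbb{R})$ is $\|g\|_{\mathrm{rk}}=\mathrm{rk}(g-\mathrm{id})$ and the projectivised rank norm is $\|g\|_{\overline{\mathrm{rk}}}=\|g\|_{\mathrm{rk}}/n$. It induces the metric $d_n(A,B)=\|AB^{-1}\|_{\overline{\mathrm{rk}}}$ on $\mathrm{GL}_n(\mathbb{R})$, and $\mathrm{P}_n$ carries the subspace metric. The metric ultraproduct $\prod_{n\to\omega}(\mathrm{P}_n,\|\cdot\|_{\overline{\mathrm{rk}}})$ is the metric space obtained from the set $\prod_{n\ge1}\mathrm{P}_n$ of all sequences by identifying $(A_n)$ with $(B_n)$ iff $\lim_\omega d_n(A_n,B_n)=0$, with metric $d([A_n],[B_n])=\lim_\omega d_n(A_n,B_n)$. *)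

(* Defs.v *)
From HB Require Import structures.
From mathcomp Require Import all_boot all_order all_algebra generic_quotient.
From mathcomp Require Import all_classical all_reals all_analysis.

Set Implicit Arguments.
Unset Strict Implicit.
Unset Printing Implicit Defensive.

Import Order.TTheory GRing.Theory Num.Theory.
Import numFieldNormedType.Exports.

Local Open Scope classical_set_scope.
Local Open Scope ring_scope.
Local Open Scope quotient_scope.

Section RankMetric.
Context (R : realType).

Definition rknorm n (g : 'M[R]_n) : nat := \rank (g - 1%:M).

Definition prknorm n (g : 'M[R]_n) : R := (rknorm g)%:R / n%:R.

(* Only meaningful on invertible matrices, invmx being the identity elsewhere. *)
Definition rkdist n (A B : 'M[R]_n) : R := prknorm (A *m invmx B).

Lemma rkdistE n (A B : 'M[R]_n) : B \in unitmx ->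
  rkdist A B = (\rank (A - B))%:R / n%:R.
Proof.
move=> uB; rewrite /rkdist /prknorm /rknorm.
rewrite -(mulmxV uB) -mulmxBl mxrankMfree //.
by rewrite row_free_unit unitmx_inv.
Qed.

Lemma rkdist_le1 n (A B : 'M[R]_n) : rkdist A B <= 1.
Proof.
rewrite /rkdist /prknorm; case: n A B => [|n] A B.
  by rewrite invr0 mulr0 ler01.
by rewrite ler_pdivrMr ?ltr0n // mul1r ler_nat rank_leq_row.
Qed.

Lemma rkdistxx n (A : 'M[R]_n) : A \in unitmx -> rkdist A A = 0.
Proof. by move=> uA; rewrite rkdistE // subrr mxrank0 mul0r. Qed.

Lemma rkdist_eq0 n (A B : 'M[R]_n) : B \in unitmx -> rkdist A B = 0 -> A = B.
Proof.
case: n A B => [|n] A B uB; first by rewrite !(flatmx0 _).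
rewrite rkdistE // => /eqP; rewrite mulf_eq0 invr_eq0 !pnatr_eq0 orbF.
by rewrite mxrank_eq0 subr_eq0 => /eqP.
Qed.

Lemma rkdistC n (A B : 'M[R]_n) : A \in unitmx -> B \in unitmx ->
  rkdist A B = rkdist B A.
Proof. by move=> uA uB; rewrite !rkdistE // -mxrank_opp opprB. Qed.

Lemma rkdist_triangle n (A B C : 'M[R]_n) : B \in unitmx -> C \in unitmx ->
  rkdist A C <= rkdist A B + rkdist B C.
Proof.
move=> uB uC; rewrite !rkdistE // -mulrDl ler_wpM2r ?invr_ge0 ?ler0n //.
by rewrite -natrD ler_nat -[A - C](subrKA B) mxrank_add.
Qed.

Definition posdef_pred n (A : 'M[R]_n) : bool :=
  (A \is symmetricmx) &&
  `[< forall v : 'cV[R]_n, v != 0 -> 0 < (v^T *m A *m v) 0 0 >].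

Record posdef n := Posdef { posdef_val :> 'M[R]_n; _ : posdef_pred posdef_val }.

HB.instance Definition _ n := [isSub for @posdef_val n].
HB.instance Definition _ n := [Choice of posdef n by <:].

Lemma posdef_unit n (A : posdef n) : (A : 'M[R]_n) \in unitmx.
Proof.
case: A => A /= /andP[_ /asboolP pA].
rewrite -unitmx_tr -row_free_unit -kermx_eq0; apply/negP => /negP.
move=> /rowV0Pn[v /sub_kermxP vA v0].
have := pA v^T; rewrite trmx_eq0 => /(_ v0).
by rewrite -mulmxA -[A]trmxK -trmx_mul vA trmx0 mulmx0 mxE ltxx.
Qed.

HB.instance Definition _ n := @isMetric.Build R (posdef n)
  (fun A B => rkdist A B)
  (fun A => rkdistxx (posdef_unit A))
  (fun A B h => val_inj (rkdist_eq0 (posdef_unit B) h))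
  (fun A B => rkdistC (posdef_unit A) (posdef_unit B))
  (fun B A C => rkdist_triangle A (posdef_unit B) (posdef_unit C)).

Lemma posdef_mdistE n (A B : posdef n) : mdist A B = rkdist A B.
Proof. by []. Qed.

End RankMetric.

Definition nonprincipal T (F : set_system T) : Prop :=
  forall x, F <> principal_filter x.

(* Uniform boundedness guarantees that limits of distances along an
   ultrafilter exist (ultradist_cvg below). *)
Definition bounded_family (R : realType) (I : Type) (X : I -> metricType R) :=
  exists M : R, forall i (x y : X i), mdist x y <= M.

Section MetricUltraproduct.
Context (R : realType) (I : Type) (X : I -> metricType R).
Context (bX : bounded_family X) (omega : set_system I).
Context (Uomega : UltraFilter omega).

Definition ultradist (x y : forall i, X i) : R :=
  lim (mdist (x i) (y i) @[i --> omega]).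

Lemma ultradist_cvg (x y : forall i, X i) :
  cvg (mdist (x i) (y i) @[i --> omega]).
Proof.
have [M bM] := bX.
pose f i := mdist (x i) (y i).
have UG : UltraFilter (f @ omega).
  split; [exact: fmap_proper_filter | move=> G PG sG].
  apply/seteqP; split => // A GA.
  have [//|wA] := in_ultra_setVsetC (f @^-1` A) Uomega.
  have GcA : G (~` A) by exact: sG.
  have : G (A `&` ~` A) by exact: filterI.
  by rewrite setICr => /filter_ex[].
have := @segment_compact R 0 M; rewrite compact_ultra => /(_ _ UG).
have omegaM : omega (f @^-1` `[0, M]).
  by apply: filterE => i; rewrite /= in_itv /= mdist_ge0 bM.
by case/(_ omegaM) => l [_ fl]; apply/cvg_ex; exists l.
Qed.

Lemma ultradistxx x : ultradist x x = 0.
Proof.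
rewrite /ultradist (_ : (fun i => _) = cst 0) ?lim_cst //.
by apply/funext => i; rewrite mdistxx.
Qed.

Lemma ultradistC x y : ultradist x y = ultradist y x.
Proof.
rewrite /ultradist; congr (lim (_ @ omega)).
by apply/funext => i; rewrite metric_sym.
Qed.

Lemma ultradist_ge0 x y : 0 <= ultradist x y.
Proof.
apply: limr_ge; first exact: ultradist_cvg.
by apply: filterE => i; exact: mdist_ge0.
Qed.

Lemma ultradist_triangle y x z :
  ultradist x z <= ultradist x y + ultradist y z.
Proof.
have Fo : Filter omega by exact: filter_filter.
have cxy := @ultradist_cvg x y; have cyz := @ultradist_cvg y z.
have cxz := @ultradist_cvg x z; have cD := is_cvgD (FF := Fo) cxy cyz.
have cB := is_cvgB (FF := Fo) cD cxz.
rewrite /ultradist -limD // -subr_ge0 -limB //.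
apply: limr_ge cB _.
by apply: filterE => i; rewrite subr_ge0; exact: metric_triangle.
Qed.

Definition ultraeq (x y : forall i, X i) : bool := ultradist x y == 0.

Lemma ultraeq_equiv : equiv_class_of ultraeq.
Proof.
split=> [x|x y|y x z]; rewrite /ultraeq ?ultradistxx // 1?ultradistC //.
move=> /eqP xy /eqP yz; apply/eqP/le_anti; rewrite ultradist_ge0 andbT.
by rewrite (le_trans (ultradist_triangle y _ _)) // ultradistC xy yz addr0.
Qed.

Canonical ultraeq_rel := EquivRelPack ultraeq_equiv.

Definition ultraproduct : Type := {eq_quot ultraeq_rel}.

HB.instance Definition _ := Choice.on ultraproduct.
HB.instance Definition _ := EqQuotient.on ultraproduct.

Definition uclass (x : forall i, X i) : ultraproduct := \pi_ultraproduct x.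

Definition uclass_dist (a b : ultraproduct) : R := ultradist (repr a) (repr b).

Lemma uclass_eqP x y : uclass x = uclass y <-> ultradist x y = 0.
Proof. by split => [/eqmodP/eqP|xy]; last by apply/eqmodP/eqP. Qed.

Lemma uclass_distE x y : uclass_dist (uclass x) (uclass y) = ultradist x y.
Proof.
have le u v u' v' : ultradist u u' = 0 -> ultradist v' v = 0 ->
    ultradist u v <= ultradist u' v'.
  move=> uu vv; rewrite (le_trans (ultradist_triangle u' _ _)) // uu add0r.
  by rewrite (le_trans (ultradist_triangle v' _ _)) // vv addr0.
have ex u : ultradist (repr (uclass u)) u = 0.
  by apply/uclass_eqP; rewrite /uclass reprK.
apply/le_anti/andP; split; apply: le; rewrite ?ex //; by rewrite ultradistC ex.
Qed.

Let uclass_distxx a : uclass_dist a a = 0.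
Proof. exact: ultradistxx. Qed.

Let uclass_dist_eq0 a b : uclass_dist a b = 0 -> a = b.
Proof. by move=> /uclass_eqP; rewrite /uclass !reprK. Qed.

Let uclass_distC a b : uclass_dist a b = uclass_dist b a.
Proof. exact: ultradistC. Qed.

Let uclass_dist_triangle b a c :
  uclass_dist a c <= uclass_dist a b + uclass_dist b c.
Proof. exact: ultradist_triangle. Qed.

HB.instance Definition _ := @isMetric.Build R ultraproduct uclass_dist
  uclass_distxx uclass_dist_eq0 uclass_distC uclass_dist_triangle.

Lemma ultraproduct_mdistE x y :
  mdist (uclass x) (uclass y) = lim (mdist (x i) (y i) @[i --> omega]).
Proof. exact: uclass_distE. Qed.

End MetricUltraproduct.

Lemma posdef_bounded (R : realType) :
  bounded_family (fun n : nat => posdef R n.+1 : metricType R).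
Proof. by exists 1 => n A B; exact: rkdist_le1. Qed.

(* The dimensions n >= 1 are reindexed as n.+1 with n : nat, so omega is the
   corresponding ultrafilter on nat. *)
Definition posdef_ultraproduct (R : realType) (omega : set_system nat)
    (Uomega : UltraFilter omega) : metricType R :=
  ultraproduct (posdef_bounded R) Uomega.

Definition contractible (R : realType) (T : topologicalType) : Prop :=
  exists (c : T) (H : T * R -> T),
    [/\ {within [set: T] `*` `[0, 1], continuous H},
        forall x, H (x, 0) = x
      & forall x, H (x, 1) = c].

(* Main.v *)
Require Import Defs.
From mathcomp Require Import all_boot all_order all_algebra.
From mathcomp Require Import all_classical all_reals all_analysis.
From mathcomp Require Import ring lra.

(* Replacing the first k rows and columns of a positive definite n x n matrix A
   by those of the identity gives a positive definite matrix, namely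
   P A P + (1 - P) for a coordinate projection P. This operation does not
   increase the rank distance between two matrices, and moves a matrix by at
   most 3 |k - l| / n when k changes to l. Taking k = floor (t n) and letting t
   run from 0 to 1 thus gives a homotopy of the ultraproduct from the identity
   map to a constant, 1-Lipschitz in the point and 3-Lipschitz in the time. The
   rounding of t n costs O(1/n), which vanishes in the limit because omega is
   non-principal. *)

Set Implicit Arguments.
Unset Strict Implicit.
Unset Printing Implicit Defensive.

Import Order.TTheory GRing.Theory Num.Theory.
Import numFieldNormedType.Exports.

Local Open Scope classical_set_scope.
Local Open Scope ring_scope.

Section IdentityCorner.
Context (R : realType) (n : nat).
Implicit Types (k l : nat) (A B : 'M[R]_n) (v : 'cV[R]_n).

Definition idcorner k A : 'M[R]_n :=
  copid_mx k *m A *m copid_mx k + pid_mx k.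

Lemma tr_copid_mx k : (copid_mx k : 'M[R]_n)^T = copid_mx k.
Proof. by rewrite /copid_mx linearB /= trmx1 tr_pid_mx. Qed.

Lemma mul_trmx_ge0 v : 0 <= (v^T *m v) 0 0.
Proof.
by rewrite mxE sumr_ge0 // => i _; rewrite mxE -expr2 sqr_ge0.
Qed.

Lemma mul_trmx_gt0 v : v != 0 -> 0 < (v^T *m v) 0 0.
Proof.
move=> v0; rewrite lt_neqAle mul_trmx_ge0 andbT eq_sym.
apply: contra v0; rewrite mxE psumr_eq0; last first.
  by move=> i _; rewrite mxE -expr2 sqr_ge0.
move=> /allP v0; apply/eqP/matrixP => i j; rewrite ord1 [RHS]mxE.
have := v0 i (mem_index_enum _).
by rewrite mxE -expr2 sqrf_eq0 => /eqP.
Qed.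

Lemma posdef_pred1 : posdef_pred (1%:M : 'M[R]_n).
Proof.
apply/andP; split; last first.
  by apply/asboolP => v v0; rewrite mulmx1 mul_trmx_gt0.
by rewrite is_hermitianmxE expr0 scale1r map_mx_id // trmx1.
Qed.

(** With [Q] a symmetric idempotent and [P = 1 - Q], the quadratic form at [v] is that of [A] at
    [P *m v] plus the squared norm of [Q *m v]. If [P *m v] vanishes, then [v = Q *m v] and the
    second term is positive. *)
Lemma idcorner_posdef k A : posdef_pred A -> posdef_pred (idcorner k A).
Proof.
move=> /andP[symA /asboolP pA].
(* The semiring instance carried by copid_mx blocks rewriting with trmx_mul. *)
have trM m p q := @trmx_mul R m p q.
apply/andP; split.
  move: symA; rewrite !is_hermitianmxE !expr0 !scale1r !map_mx_id //.
  move=> /eqP sA; apply/eqP; rewrite /idcorner [RHS]linearD /=.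
  by rewrite !trM -sA tr_pid_mx tr_copid_mx mulmxA.
apply/asboolP => v v0; set P : 'M[R]_n := copid_mx k.
pose Q : 'M[R]_n := pid_mx k.
have QQ : Q = Q^T *m Q by rewrite tr_pid_mx mul_pid_mx minnn pid_mx_minh.
have -> : v^T *m idcorner k A *m v =
    (P *m v)^T *m A *m (P *m v) + (Q *m v)^T *m (Q *m v).
  rewrite /idcorner mulmxDr mulmxDl -/Q [in LHS]QQ !trM.
  by rewrite tr_copid_mx !mulmxA.
rewrite mxE; have [Pv0|Pv0] := eqVneq (P *m v) 0; last first.
  by rewrite ltr_wpDr ?mul_trmx_ge0 ?pA.
have Qv : v = Q *m v.
  by apply: subr0_eq; rewrite -Pv0 /P /copid_mx mulmxBl mul1mx.
by rewrite -Qv Pv0 mulmx0 [X in X + _]mxE add0r mul_trmx_gt0.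
Qed.

Lemma idcorner0 A : idcorner 0 A = A.
Proof. by rewrite /idcorner /copid_mx pid_mx_0 subr0 mul1mx mulmx1 addr0. Qed.

Lemma idcorner_full A : idcorner n A = 1%:M.
Proof. by rewrite /idcorner /copid_mx pid_mx_1 subrr !mul0mx add0r. Qed.

(** The added corners cancel, leaving [A - B] multiplied by a projection on both sides. *)
Lemma mxrank_idcornerB k A B :
  (\rank (idcorner k A - idcorner k B)%R <= \rank (A - B)%R)%N.
Proof.
rewrite /idcorner opprD addrACA subrr addr0 -mulmxBl -mulmxBr.
exact: leq_trans (mxrankM_maxl _ _) (mxrankM_maxr _ _).
Qed.

Lemma mxrank_pid_mxS k :
  (\rank ((pid_mx k.+1 : 'M[R]_n) - pid_mx k)%R <= 1)%N.
Proof.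
have [kn|nk] := ltnP k n.
  rewrite (_ : _ - _ = delta_mx (Ordinal kn) (Ordinal kn)) ?mxrank_delta //.
  apply/matrixP => i j; rewrite !mxE -!val_eqE /= ltnS.
  case: (eqVneq (i : nat) (j : nat)) => [<-|ij] /=.
    by rewrite andbb; case: ltngtP; rewrite ?subrr ?subr0.
  case: eqP => [ik|_]; last by rewrite subrr.
  by move: ij; rewrite ik eq_sym => /negPf ->; rewrite subrr.
(* For [n <= k] both matrices are the identity. *)
rewrite -[pid_mx k.+1]pid_mx_minh -[pid_mx k]pid_mx_minh.
by rewrite !(minn_idPl _) ?leqW // subrr mxrank0.
Qed.

(** The 3 counts the terms [D *m A *m copid_mx k], [copid_mx k.+1 *m A *m D] and [- D], where
    [D = pid_mx k.+1 - pid_mx k] has rank at most 1. *)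
Lemma mxrank_idcornerS k A :
  (\rank (idcorner k A - idcorner k.+1 A)%R <= 3)%N.
Proof.
set D : 'M[R]_n := pid_mx k.+1 - pid_mx k.
have PD : copid_mx k = copid_mx k.+1 + D by rewrite /D /copid_mx addrA subrK.
have -> : idcorner k A - idcorner k.+1 A =
    D *m A *m copid_mx k + copid_mx k.+1 *m A *m D +
    (pid_mx k - pid_mx k.+1).
  rewrite /idcorner.
  have -> : copid_mx k *m A *m copid_mx k = copid_mx k.+1 *m A *m D +
      copid_mx k.+1 *m A *m copid_mx k.+1 + D *m A *m copid_mx k.
    rewrite {1}PD (mulmxDl _ D) (mulmxDl _ (D *m A)) {1}PD mulmxDr.
    by rewrite [X in X + _]addrC.
  rewrite opprD [_ + D *m A *m _]addrC -!addrA; congr (_ + (_ + _)).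
  by rewrite addrCA addNKr.
have rD : (\rank D <= 1)%N by exact: mxrank_pid_mxS.
rewrite (leq_trans (mxrank_add _ _)) // -[3%N]/(2 + 1)%N.
rewrite leq_add //; last by rewrite -mxrank_opp opprB.
rewrite (leq_trans (mxrank_add _ _)) // -[2%N]/(1 + 1)%N.
rewrite leq_add //; last exact: leq_trans (mxrankM_maxr _ _) rD.
by rewrite -mulmxA; exact: leq_trans (mxrankM_maxl _ _) rD.
Qed.

Lemma mxrank_idcornerD k m A :
  (\rank (idcorner k A - idcorner (k + m) A)%R <= 3 * m)%N.
Proof.
elim: m => [|m IH]; first by rewrite addn0 subrr mxrank0.
rewrite -[X in \rank X](subrKA (idcorner (k + m) A)).
rewrite (leq_trans (mxrank_add _ _)) // addnS mulnSr.
by rewrite leq_add ?mxrank_idcornerS.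
Qed.

Definition posdef_idcorner k (A : posdef R n) : posdef R n :=
  Posdef (idcorner_posdef k (valP A)).

Lemma mdist_idcorner k (A B : posdef R n) :
  mdist (posdef_idcorner k A) (posdef_idcorner k B) <= mdist A B.
Proof.
rewrite !posdef_mdistE !rkdistE ?posdef_unit //.
by rewrite ler_wpM2r ?invr_ge0 ?ler0n // ler_nat mxrank_idcornerB.
Qed.

Lemma mdist_idcorner_index k l (A : posdef R n) : (k <= l)%N ->
  mdist (posdef_idcorner k A) (posdef_idcorner l A) <= 3 * (l - k)%:R / n%:R.
Proof.
move=> kl; rewrite posdef_mdistE rkdistE ?posdef_unit //.
rewrite ler_wpM2r ?invr_ge0 ?ler0n // -natrM ler_nat /=.
by rewrite -{1}(subnKC kl) mxrank_idcornerD.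
Qed.

End IdentityCorner.

Lemma truncn_dist (R : realType) (x y : R) : x <= y ->
  (Num.trunc y - Num.trunc x)%:R <= y - x + 1.
Proof.
move=> xy; rewrite natrB ?le_truncn //.
have [y0|y0] := leP 0 y.
  have := truncnS_gt x; rewrite -natr1; move: y0; rewrite -truncn_le.
  lra.
(* For negative [y] both truncations take the value 0. *)
have y1 : ~~ (1 <= y) by lra.
have x1 : ~~ (1 <= x) by lra.
move/truncn0Pn: y1 => ->; move/truncn0Pn: x1 => ->; lra.
Qed.

(** The two indices differ by at most [|s - t| * n.+1 + 1], the 1 coming from rounding, and each
    unit of index costs at most [3 / n.+1]. *)
Lemma mdist_idcorner_trunc (R : realType) (n : nat) (s t : R)
    (A : posdef R n.+1) :
  mdist (posdef_idcorner (Num.trunc (s * n.+1%:R)) A)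
        (posdef_idcorner (Num.trunc (t * n.+1%:R)) A) <=
  3 * `|s - t| + 3 * n.+1%:R^-1.
Proof.
wlog st : s t / s <= t.
  move=> W; have [/W //|/ltW /W] := leP s t.
  by rewrite metric_sym distrC.
have N0 : 0 < n.+1%:R :> R by rewrite ltr0n.
have sNtN : s * n.+1%:R <= t * n.+1%:R by rewrite ler_pM2r.
apply: le_trans (mdist_idcorner_index _ (le_truncn sNtN)) _.
rewrite ler0_norm ?subr_le0 // ler_pdivrMr //.
rewrite [leRHS](_ : _ = 3 * (t * n.+1%:R - s * n.+1%:R + 1)); last first.
  by rewrite mulrDl divfK ?gt_eqF //; ring.
by rewrite ler_pM2l ?ltr0n // truncn_dist.
Qed.

(** Otherwise [omega] contains an initial segment. Removing its points from the top, one either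
    finds a singleton in [omega], which makes [omega] principal, or reaches the empty set. *)
Lemma nonprincipal_ultra_cofinite (omega : set_system nat)
    (Uomega : UltraFilter omega) :
  nonprincipal omega -> \oo `<=` omega.
Proof.
move=> np A [N _ NA].
have [//|oA] := in_ultra_setVsetC A Uomega.
have : omega `I_N.
  apply: filterS oA => i Ai /=; rewrite ltnNge; apply/negP => Ni.
  exact/Ai/NA.
elim: N {NA} => [|N IH] oN; first by have [] := filter_ex oN.
have [/IH //|oNC] := in_ultra_setVsetC `I_N Uomega.
have oset1 : omega [set N].
  apply: filterS (filterI oN oNC) => i [/= iN /negP].
  by rewrite -leqNgt => Ni; apply/eqP; rewrite eqn_leq Ni -ltnS iN.
(* Every set of [omega] meets [[set N]], so [omega] lies in the principal filter at [N] and equals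
   it by maximality. *)
case: (np N); apply/esym/(@max_filter _ _ Uomega).
  exact: principal_filter_proper.
move=> W oW; apply/principal_filterP.
by have [i [Wi /= <-]] := filter_ex (filterI oW oset1).
Qed.

Section Contraction.
Context (R : realType) (omega : set_system nat).
Context (Uomega : UltraFilter omega) (npomega : nonprincipal omega).

Let bP := posdef_bounded R.
Let T := posdef_ultraproduct R Uomega.

(** Working on [repr x] spares a descent to the quotient: the distance of the ultraproduct is itself
    computed on these representatives. *)
Definition contraction_seq (x : T) (t : R) : forall n, posdef R n.+1 :=
  fun n => posdef_idcorner (Num.trunc (t * n.+1%:R)) (repr x n).

Definition contraction (p : T * R) : T :=
  uclass bP Uomega (contraction_seq p.1 p.2).

Lemma contraction_dist_point (x y : T) (t : R) :
  mdist (contraction (x, t)) (contraction (y, t)) <= mdist x y.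
Proof.
rewrite -[leRHS]/(ultradist omega (repr x) (repr y)).
rewrite /contraction ultraproduct_mdistE.
apply: ler_lim; [exact: (ultradist_cvg bP)|exact: (ultradist_cvg bP)|].
by apply: filterE => n; exact: mdist_idcorner.
Qed.

Lemma contraction_dist_time (x : T) (s t : R) :
  mdist (contraction (x, s)) (contraction (x, t)) <= 3 * `|s - t|.
Proof.
rewrite /contraction ultraproduct_mdistE.
apply/ler_addgt0Pr => e e0; apply: limr_le; first exact: (ultradist_cvg bP).
have e3 : 0 < e / 3 by rewrite divr_gt0.
(* The rounding error [3 / n.+1] is below [e] for all large [n], hence on a set of [omega]. *)
have : \forall n \near omega, `|0 - harmonic n| < e / 3 :> R.
  apply: nonprincipal_ultra_cofinite => //.
  by have /cvgrPdist_lt := @cvg_harmonic R; apply.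
apply: filterS => n /=; rewrite sub0r normrN ger0_norm ?invr_ge0 ?ler0n //.
move=> ne; apply: le_trans (mdist_idcorner_trunc _ _ _) _.
by rewrite lerD2l mulrC -ler_pdivlMr ?ltW.
Qed.

Lemma continuous_contraction : continuous contraction.
Proof.
move=> [x t]; apply/metricType_numDomainType.cvgrPdist_lt => e e0.
(* The Lipschitz constants 1 in the point and 3 in the time give [e / 2 + 3 * (e / 6) = e], passing
   through [(y, t)]. *)
have e2 : 0 < e / 2 by rewrite divr_gt0.
have e6 : 0 < e / 6 by rewrite divr_gt0.
exists (ball x (e / 2), ball t (e / 6)).
  by split; exact: nbhsx_ballx.
move=> [y s] [/= xy ts].
move: xy; rewrite ballEmdist /= => xy.
apply: le_lt_trans (metric_triangle _ (contraction (y, t)) _) _.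
have := contraction_dist_point x y t; have := contraction_dist_time y t s.
rewrite /ball /= in ts; lra.
Qed.

Lemma contraction0 (x : T) : contraction (x, 0) = x.
Proof.
rewrite -[RHS]reprK /contraction /=; congr (uclass bP Uomega _).
apply/functional_extensionality_dep => n; apply/val_inj.
by rewrite /= mul0r truncn0 idcorner0.
Qed.

(** At time 1 the index is the full size [n.+1], so every term of the sequence is the identity
    matrix. *)
Lemma contraction1 (x y : T) : contraction (x, 1) = contraction (y, 1).
Proof.
rewrite /contraction /=; congr (uclass bP Uomega _).
apply/functional_extensionality_dep => n; apply/val_inj.
by rewrite /= mul1r natrK !idcorner_full.
Qed.

End Contraction.

Theorem proposition6p5 (R : realType) (omega : set_system nat)
    (Uomega : UltraFilter omega) (npomega : nonprincipal omega) :
  contractible R (posdef_ultraproduct R Uomega).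
Proof.
(* Any base point would do here, as the image at time 1 is the same for all points. *)
pose I : posdef_ultraproduct R Uomega :=
  uclass (posdef_bounded R) Uomega (fun n => Posdef (posdef_pred1 R n.+1)).
exists (contraction (I, 1)), (@contraction R omega Uomega); split.
- exact/continuous_subspaceT/continuous_contraction.
- exact: contraction0.
- by move=> x; exact: contraction1.
Qed.
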